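(* Let $n>5$ and let $S\in\mathcal D_n^s$ be such that both of its directed cycles have even length. Then: (i) if $n\equiv 0\pmod 4$, the maximal energy among such $S$ is attained by $S\cong D_n^s[2,n-2]$; (ii) if $n\equiv 2\pmod 4$, it is attained by $S\cong D_n^s[2,\boldsymbol{n-2}]$; (iii) if $n\equiv 1\pmod 4$, it is attained by $S\cong D_n^s[2,n-3]$; (iv) if $n\equiv 3\pmod 4$, it is attained by $S\cong D_n^s[2,\boldsymbol{n-3}]$; (v) the minimal energy among such $S$ is attained by $S\cong D_n^s[\boldsymbol 2,\boldsymbol 2]$ (whose energy is $0$).
   Context: A signed digraph (sidigraph) is a digraph in which every arc carries a sign $+1$ or $-1$; its adjacency matrix $A(S)=[a_{ij}]$ has $a_{ij}$ equal to the sign of the arc $w_iw_j$ if it exists and $0$ otherwise. If $\rho_1,\dots,\rho_n$ are the eigenvalues of $A(S)$, the energy of $S$ is $E(S)=\sum_{k=1}^n|\mathrm{Re}(\rho_k)|$. The sign of a directed cycle is the product of the signs of its arcs. For $k\ge 2$, $C_k$ denotes a directed cycle of length $k$ with sign $+1$ and $\boldsymbol{C}_k$ a directed cycle of length $k$ with sign $-1$. It is known that $E(C_k)=2\cot\frac{\pi}{k}$ if $k\equiv0\pmod 4$, $2\csc\frac{\pi}{k}$ if $k\equiv 2\pmod 4$, $\csc\frac{\pi}{2k}$ if $k$ is odd; and $E(\boldsymbol C_k)=2\csc\frac{\pi}{k}$ if $k\equiv0\pmod 4$, $2\cot\frac{\pi}{k}$ if $k\equiv 2\pmod 4$, $\csc\frac{\pi}{2k}$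 if $k$ is odd. $\mathcal D_n^s$ is the class of sidigraphs on $n$ vertices whose underlying graph is connected and which contain exactly two directed cycles, these two cycles being vertex-disjoint (bicyclic vertex-disjoint sidigraphs). The energy of $S\in\mathcal D_n^s$ equals the sum of the energies of its two directed cycles. For integers $p,q\ge 2$ with $p+q\le n$, $D_n^s[p,q]$, $D_n^s[\boldsymbol p,\boldsymbol q]$, $D_n^s[\boldsymbol p,q]$, $D_n^s[p,\boldsymbol q]$ denote a member of $\mathcal D_n^s$ whose two directed cycles have lengths $p$ and $q$, where a bold entry indicates that the cycle of that length is negative and a non-bold entry that it is positive; its energy is e.g. $E(D_n^s[p,\boldsymbol q])=E(C_p)+E(\boldsymbol C_q)$. *)

(* Defs.v *)
From HB Require Import structures.
From mathcomp Require Import all_boot all_order all_algebra all_field.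
Set Implicit Arguments. Unset Strict Implicit. Unset Printing Implicit Defensive.
Import Order.TTheory GRing.Theory Num.Theory.
Local Open Scope ring_scope.

(* A sidigraph on n vertices: adjacency matrix A(S) = [a_ij] with
   a_ij = sign of arc w_i w_j (+1 / -1) if it exists, 0 otherwise.
   Digraphs are simple: no loops. *)
Definition sidigraph (n : nat) (A : 'M[int]_n) : Prop :=
  (forall i j, A i j \in [:: -1; 0; 1]) /\ (forall i, A i i = 0).

Definition arc (n : nat) (A : 'M[int]_n) : rel 'I_n := fun i j => A i j != 0.

Definition arcs_of (n : nat) (s : seq 'I_n) : {set 'I_n * 'I_n} :=
  [set (x, next s x) | x in s].

Definition is_dicycle (n : nat) (A : 'M[int]_n) (C : {set 'I_n * 'I_n}) : Prop :=
  exists s : seq 'I_n,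
    [/\ uniq s, (1 < size s)%N, cycle (arc A) s & C = arcs_of s].

Definition cycle_length (n : nat) (C : {set 'I_n * 'I_n}) : nat := #|C|.

Definition cycle_vertices (n : nat) (C : {set 'I_n * 'I_n}) : {set 'I_n} :=
  [set p.1 | p in C].

Definition cycle_sign (n : nat) (A : 'M[int]_n) (C : {set 'I_n * 'I_n}) : int :=
  \prod_(p in C) A p.1 p.2.

Definition underlying_connected (n : nat) (A : 'M[int]_n) : Prop :=
  forall u v : 'I_n, connect (fun x y => arc A x y || arc A y x) u v.

Definition in_Dns (n : nat) (A : 'M[int]_n) : Prop :=
  [/\ sidigraph A, underlying_connected A &
      exists C1 C2, [/\ C1 != C2, is_dicycle A C1, is_dicycle A C2,
        [disjoint cycle_vertices C1 & cycle_vertices C2] &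
        forall C, is_dicycle A C -> C = C1 \/ C = C2]].

(* S has two directed cycles of lengths p, q and signs sp, sq;
   i.e. S is (isomorphic to) D_n^s[p,q] with the given boldness *)
Definition of_type (n : nat) (A : 'M[int]_n) (p : nat) (sp : int) (q : nat) (sq : int) : Prop :=
  exists C1 C2, [/\ C1 != C2, is_dicycle A C1, is_dicycle A C2,
    (cycle_length C1 = p /\ cycle_sign A C1 = sp) &
    (cycle_length C2 = q /\ cycle_sign A C2 = sq)].

Definition even_cycles (n : nat) (A : 'M[int]_n) : Prop :=
  forall C, is_dicycle A C -> ~~ odd (cycle_length C).

Definition eigenvalues (n : nat) (A : 'M[int]_n) : seq algC :=
  projT1 (closed_field_poly_normal (char_poly (map_mx intr A : 'M[algC]_n))).

Definition energy (n : nat) (A : 'M[int]_n) : algC :=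
  \sum_(z <- eigenvalues A) `|'Re z|.

Definition max_even_attained_by (n p : nat) (sp : int) (q : nat) (sq : int) : Prop :=
  (exists T : 'M[int]_n, in_Dns T /\ of_type T p sp q sq) /\
  (forall S T : 'M[int]_n, in_Dns S -> even_cycles S ->
     in_Dns T -> of_type T p sp q sq -> energy S <= energy T).

(* Main.v *)
Require Import Defs.
From HB Require Import structures.
From mathcomp Require Import all_boot all_order fingroup perm all_algebra all_field.
From mathcomp Require Import ring lra zify.
Set Implicit Arguments. Unset Strict Implicit. Unset Printing Implicit Defensive.
Import Order.TTheory GRing.Theory Num.Theory.
Local Open Scope ring_scope.

(* In the Leibniz expansion of det (X - A) only the four products of the two directed
   cycles survive, so the characteristic polynomial is X^r (X^p - s_1) (X^q - s_2).
   The roots of X^(2a) - s contribute 2 csc (pi / 2a) to the energy if s = (-1)^(a+1), and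
   2 cot (pi / 2a) otherwise. With D_a = csc (pi / 2a), everything then follows from the
   monotonicity of D and from D_a + D_b <= 1 + D_(a+b-1).
   All angles are multiples of x = pi / 2N for a large common multiple N, so that only
   finite trigonometry in the real algebraic numbers is needed. The last inequality is
   obtained by comparing D_a with its asymptote a L, where L = 1 / (N sin x) plays the
   role of 2 / pi: one has a L <= D_a <= a L + tan (pi / 4a) / 2. *)

(** * Trigonometry of the multiples of a fixed angle *)

(* S i = sin (i pi / 2N) and C i = cos (i pi / 2N); the last field expresses that the
   angle is pi / 2N and not another one with the same sine and cosine at N. *)
Record trig_table (F : realFieldType) (N : nat) (S C : nat -> F) : Prop :=
  TrigTable {
    trigDS : forall i j, S (i + j)%N = S i * C j + C i * S j;
    trigDC : forall i j, C (i + j)%N = C i * C j - S i * S j;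
    trig_sqr : forall i, S i ^+ 2 + C i ^+ 2 = 1;
    trigS0 : S 0%N = 0;
    trigC0 : C 0%N = 1;
    trigSN : S N = 1;
    trigCN : C N = 0;
    trigS_ge0 : forall i, (i <= N.*2)%N -> 0 <= S i }.

Section Trig.

Variables (F : realFieldType) (N : nat) (S C : nat -> F).
Hypothesis trigT : trig_table N S C.

Let DS := trigDS trigT.
Let DC := trigDC trigT.
Let SC1 := trig_sqr trigT.
Let S0 := trigS0 trigT.
Let SN := trigSN trigT.
Let CN := trigCN trigT.
Let S_ge0 := trigS_ge0 trigT.

Lemma trigSDN i : S (i + N)%N = C i.
Proof. by rewrite DS SN CN mulr0 add0r mulr1. Qed.

Lemma trigC_ge0 i : (i <= N)%N -> 0 <= C i.
Proof. by move=> iN; rewrite -trigSDN S_ge0 // -addnn leq_add2r. Qed.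

Lemma trigC_le1 i : C i <= 1.
Proof. have := SC1 i; nra. Qed.

Lemma trigS_double i : S i.*2 = 2 * S i * C i.
Proof. by rewrite -addnn DS; ring. Qed.

Lemma trigC_double i : C i.*2 = 1 - 2 * S i ^+ 2.
Proof. by rewrite -addnn DC; have := SC1 i; lra. Qed.

(** Here sin^2 j - sin^2 i = sin (j - i) sin (j + i), and both angles on the right lie in
    [0, pi]. *)
Lemma trigS_mono i j : (i <= j <= N)%N -> S i <= S j.
Proof.
case/andP=> leij lejN; have [d def_j] : {d | j = i + d}%N by exists (j - i)%N; lia.
have Sj0 : 0 <= S j by apply: S_ge0; lia.
have sqr_diff : S j ^+ 2 - S i ^+ 2 = S d * S (i + j)%N.
  rewrite DS def_j DS DC; have := SC1 d; have := SC1 i; nra.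
have d0 : 0 <= S d by apply: S_ge0; lia.
have ij0 : 0 <= S (i + j)%N by apply: S_ge0; lia.
rewrite -(@ler_pXn2r _ 2) ?nnegrE //; last by apply: S_ge0; lia.
by rewrite -subr_ge0 sqr_diff mulr_ge0.
Qed.

Lemma trigS_mul k j : (k * j <= N.*2)%N -> S (k * j)%N <= k%:R * S j.
Proof.
elim: k => [|k IHk] le_kj; first by rewrite mul0n S0 mul0r.
have le_kj' : (k * j <= N.*2)%N by lia.
have {}IHk := IHk le_kj'.
have [-> | j_gt0] := posnP j; first by rewrite muln0 S0 mulr0.
have Sj : 0 <= S j by apply: S_ge0; lia.
have Skj : 0 <= S (k * j)%N by apply: S_ge0.
rewrite mulSn DS -natr1.
have := trigC_le1 j; have := trigC_le1 (k * j)%N; nra.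
Qed.

(** This is k tan j <= tan (k j), with denominators cleared so that it still makes sense at the
    right angle [k * j = N]. *)
Lemma trig_tan_mul k j : (k * j <= N)%N ->
  k%:R * S j * C (k * j)%N <= S (k * j)%N * C j.
Proof.
elim: k => [|k IHk] le_kj; first by rewrite mul0n S0 !mul0r.
have le_kj' : (k * j <= N)%N by lia.
have {}IHk := IHk le_kj'.
have Skj : 0 <= S (k * j)%N by apply: S_ge0; lia.
have Cj : 0 <= C j by apply: trigC_ge0; lia.
have k0 : 0 <= k%:R :> F by apply: ler0n.
rewrite mulSn DS DC -natr1 -subr_ge0.
have -> : (S j * C (k * j)%N + C j * S (k * j)%N) * C j -
  (k%:R + 1) * S j * (C j * C (k * j)%N - S j * S (k * j)%N) =
  C j * (S (k * j)%N * C j - k%:R * S j * C (k * j)%N) +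
  (k%:R + 1) * S j ^+ 2 * S (k * j)%N by ring.
apply: addr_ge0; first by rewrite mulr_ge0 // subr_ge0.
apply: mulr_ge0 => //; apply: mulr_ge0; [exact: addr_ge0 | exact: sqr_ge0].
Qed.

(** The table only provides nonnegative sines; strictness starts from 1 = sin (pi / 2) <= N sin
    x. *)
Lemma trigS_gt0 i : (0 < i <= N)%N -> 0 < S i.
Proof.
case/andP=> i_gt0 iN; apply: (@lt_le_trans _ _ (S 1%N)); last first.
  by apply: trigS_mono; rewrite i_gt0.
have := @trigS_mul N 1; rewrite muln1 SN => /(_ ltac:(lia)) le1.
by rewrite -(@pmulr_rgt0 _ N%:R) ?ltr0n; [exact: lt_le_trans le1 | lia].
Qed.

Lemma trig_half k : N = k.*2 -> S k ^+ 2 = 2^-1 /\ C k = S k.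
Proof.
move=> defN; have := trigC_double k; rewrite -defN CN => /eqP.
have Sk : 0 <= S k by apply: S_ge0; lia.
have Ck : 0 <= C k by apply: trigC_ge0; lia.
move=> /eqP C0k; have := SC1 k => SCk.
have S2 : S k ^+ 2 = 2^-1 by lra.
split=> //; apply/eqP; rewrite -(@eqrXn2 _ 2) //; apply/eqP; lra.
Qed.

Lemma trig_third k : N = (3 * k)%N -> S k = 2^-1.
Proof.
move=> defN; have Sk : 0 <= S k by apply: S_ge0; lia.
have : S N = 3 * S k - 4 * S k ^+ 3.
  rewrite defN (_ : 3 * k = k + k.*2)%N; last by lia.
  rewrite DS trigS_double trigC_double.
  have -> : S k * (1 - 2 * S k ^+ 2) + C k * (2 * S k * C k) =
    S k - 2 * S k ^+ 3 + 2 * S k * (S k ^+ 2 + C k ^+ 2) - 2 * S k ^+ 3 by ring.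
  by rewrite SC1; ring.
rewrite SN => triple.
(* The triple angle formula at pi / 2 reads 1 - 3 s + 4 s^3 = 0, whose only nonnegative root is 1 /
   2. *)
have /eqP : (S k + 1) * (2 * S k - 1) ^+ 2 = 0.
  by transitivity (1 - (3 * S k - 4 * S k ^+ 3)); [ring | rewrite -triple subrr].
rewrite mulf_eq0 expf_eq0 /=; case/orP=> /eqP; lra.
Qed.

(** * Comparison of cosecants with their asymptote *)

Let L := (N%:R * S 1%N)^-1.

Hypothesis N_gt0 : (0 < N)%N.

Let S1_gt0 : 0 < S 1%N.
Proof. exact: trigS_gt0. Qed.

Lemma trig_csc_ge m k : N = (m * k)%N -> m%:R * L <= (S k)^-1.
Proof.
move=> defN; have [m0 k0] : (0 < m)%N /\ (0 < k)%N by split; nia.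
have Sk : 0 < S k by apply: trigS_gt0; nia.
have -> : m%:R * L = (k%:R * S 1%N)^-1.
  rewrite /L defN natrM -mulrA invfM mulVKf //; by rewrite pnatr_eq0 -lt0n.
rewrite lef_pV2 ?posrE ?mulr_gt0 ?ltr0n //.
have := @trigS_mul k 1; rewrite muln1; apply; nia.
Qed.

(** With t = h x = pi / 4a, csc 2t = (cot t + tan t) / 2. Since tan t >= h tan x >= h sin x, the
    cotangent part is at most 1 / (2 h sin x) = a L. *)
Lemma trig_csc_le a h : (1 < a)%N -> N = (a * h.*2)%N ->
  (S h.*2)^-1 <= a%:R * L + S h / C h / 2.
Proof.
move=> a1 defN; have h0 : (0 < h)%N by nia.
have Sh : 0 < S h by apply: trigS_gt0; nia.
have S2h : 0 < S h.*2 by apply: trigS_gt0; nia.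
have Ch : 0 < C h.
  by have := S2h; rewrite trigS_double pmulr_rgt0 // mulr_gt0 ?ltr0n.
have -> : (S h.*2)^-1 = C h / (2 * S h) + S h / C h / 2.
  rewrite trigS_double -[LHS]mul1r -(SC1 h); field.
  by rewrite SC1 oner_neq0 !gt_eqF.

rewrite lerD2r.
have -> : a%:R * L = (2 * (h%:R * S 1%N))^-1.
  rewrite /L defN -mul2n !natrM; field.
  by rewrite !gt_eqF ?ltr0n //; lia.
have := @trig_tan_mul h 1; rewrite muln1 => /(_ ltac:(nia)) tanh.
rewrite -[C h / _]invf_div lef_pV2 ?posrE ?divr_gt0 ?mulr_gt0 ?ltr0n //.
rewrite ler_pdivlMr // -mulrA ler_pM2l //.
by apply: le_trans tanh _; rewrite ler_piMr ?trigC_le1 // ltW.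
Qed.

(** Multiplying the angle pi / 4a by a gives pi / 4, whose tangent is 1; hence a tan (pi / 4a) <=
    1. *)
Lemma trig_tan_le a h : (1 < a)%N -> N = (a * h.*2)%N -> S h <= C h / a%:R.
Proof.
move=> a1 defN; have [S2 CS] := @trig_half (a * h)%N ltac:(nia).
have Sah : 0 < S (a * h)%N by apply: trigS_gt0; nia.
have := @trig_tan_mul a h ltac:(nia); rewrite CS mulrC ler_pM2l // => le_aS.
by rewrite ler_pdivlMr 1?mulrC // ltr0n; lia.
Qed.

(* 29 / 70, 11 / 41 and 17 / 26 slightly exceed tan (pi / 8), tan (pi / 12) and
   1 / (4 sin (pi / 8)) >= L; half the sum of the first two plus the third is below 1. *)
Lemma trig_tan2_le h : N = (2 * h.*2)%N -> S h <= (29 / 70) * C h.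
Proof.
move=> defN; have [_] := @trig_half h.*2 ltac:(lia).
rewrite trigC_double trigS_double => eqt; have SCh := SC1 h.
have Sh : 0 <= S h by apply: S_ge0; lia.
have Ch : 0 <= C h by apply: trigC_ge0; lia.
rewrite leNgt; apply/negP=> lt_t; suff : 0 < 0 :> F by rewrite ltxx.
(* The tangent of pi / 8 solves t^2 + 2 t = 1, whereas 29 / 70 makes the left side exceed 1. *)
set t := 29 / 70 in lt_t.
have tC : 0 <= t * C h by rewrite mulr_ge0 // /t; lra.
have sqr_t : (t * C h) ^+ 2 <= S h ^+ 2 by rewrite ler_pXn2r ?nnegrE // ltW.
have prod_t : t * C h * C h <= S h * C h by rewrite ler_wpM2r // ltW.
rewrite exprMn in sqr_t; rewrite /t in sqr_t prod_t; lra.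
Qed.

(** From a = 4 on, the bound 1 / a is good enough. Only a = 3 needs the exact value sin (pi / 6) = 1
    / 2 of the doubled angle. *)
Lemma trig_tan_le_bound a h : (2 < a)%N -> N = (a * h.*2)%N -> S h <= (11 / 41) * C h.
Proof.
move=> a2 defN; have le_a := @trig_tan_le a h ltac:(lia) defN.
have Sh : 0 < S h by apply: trigS_gt0; nia.
have Ch : 0 <= C h by apply: trigC_ge0; nia.
have [a3 | a4] := leqP a 3; last first.
  apply: le_trans le_a _; rewrite mulrC ler_wpM2r //.
  apply: (@le_trans _ _ 4^-1); last lra.
  by rewrite lef_pV2 ?posrE ?ltr0n ?ler_nat //; lia.
have a_eq3 : a = 3%N by lia.
subst a; have := @trig_third h.*2 defN; rewrite trigS_double => St.
have SCh := SC1 h; rewrite leNgt; apply/negP=> lt_t; suff : 0 < 0 :> F by rewrite ltxx.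
nra.
Qed.

Lemma trig_L_le j : N = (4 * j)%N -> L <= 17 / 26.
Proof.
move=> defN; have [C2 CS] := @trig_half j.*2 ltac:(lia).
have Sj : 0 < S j by apply: trigS_gt0; lia.
have S2j : 0 <= S j.*2 by apply: S_ge0; lia.
have : S j <= j%:R * S 1%N.
  by have := @trigS_mul j 1; rewrite muln1; apply; lia.
(* Here j x = pi / 8, and 1 - 2 sin^2 (pi / 8) = sin (pi / 4) <= 29 / 41 bounds the sine from
   below. *)
have : 13 / 34 <= S j.
  have := trigC_double j; rewrite CS => Cd.
  have : S j.*2 <= 29 / 41 by nra.
  nra.
move=> lo le_Sj; rewrite /L defN natrM.
have jS : 0 < j%:R * S 1%N by apply: lt_le_trans le_Sj.
rewrite -[leLHS]mul1r ler_pdivrMr; last by rewrite -mulrA mulr_gt0 ?ltr0n.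
by rewrite -mulrA; lra.
Qed.

(** The linear parts of the bounds on D_a + D_b - D_(a+b-1) leave just L, so the difference is at
    most L plus half the two tangents. For 2 <= a <= b and b >= 3 the numerical bounds make this
    less than 1; the remaining pairs are done by hand. *)
Lemma trig_csc_superadd a b k1 k2 k3 :
    (8 %| N)%N -> (0 < a)%N -> (0 < b)%N -> N = (a * k1.*2)%N ->
    N = (b * k2.*2)%N -> N = ((a + b).-1 * k3)%N ->
  (S k1.*2)^-1 + (S k2.*2)^-1 <= 1 + (S k3)^-1.
Proof.
wlog leab : a b k1 k2 / (a <= b)%N => [IH N8 a0 b0 def1 def2 def3|].
  have [/IH|/ltnW/IH] := leqP a b; first exact.
  by rewrite [X in X <= _]addrC; apply; rewrite // addnC.
move=> N8 a0 b0 def1 def2 def3.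
have [a_le1 | a1] := leqP a 1.
  have a1 : a = 1%N by lia.
  subst a; rewrite mul1n in def1; rewrite -def1 SN invr1 /= in def3 *.
  suff -> : k3 = k2.*2 by [].
  by apply/eqP; rewrite -(eqn_pmul2l b0) -def2 -def3.
(* For a = b = 2 the numerical bounds add up to more than 1; instead D_2 <= 3 / 2 and D_3 = 2 are
   used. *)
have [b_le2 | b2] := leqP b 2.
  have [a2 b2] : a = 2%N /\ b = 2%N by lia.
  subst a b; rewrite (@trig_third k3) // invrK.
  have -> : k1 = k2 by lia.
  have [S2 _] := @trig_half k2.*2 ltac:(lia).
  have Sk : 0 < S k2.*2 by apply: trigS_gt0; lia.
  suff : (S k2.*2)^-1 <= 3 / 2 by lra.
  rewrite -[leLHS]mul1r ler_pdivrMr //; nra.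
have le3 := trig_csc_ge def3.
have le1 := trig_csc_le a1 def1; have le2 := @trig_csc_le b k2 ltac:(lia) def2.
have leL := @trig_L_le (N %/ 4) ltac:(lia).
have C_gt0 k a' : (1 < a')%N -> N = (a' * k.*2)%N -> 0 < C k.
  move=> a'1 defk; have : 0 < S k.*2 by apply: trigS_gt0; nia.
  rewrite trigS_double pmulr_rgt0 // mulr_gt0 ?ltr0n //; apply: trigS_gt0; nia.
have t1 : S k1 / C k1 <= (29 / 70).
  rewrite ler_pdivrMr; last exact: (C_gt0 k1 a).
  have [a_le2 | a2] := leqP a 2; first by apply: trig_tan2_le; rewrite def1; congr (_ * _)%N; lia.
  have := trig_tan_le_bound a2 def1; have := C_gt0 k1 a a1 def1; lra.
have t2 : S k2 / C k2 <= (11 / 41).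
  by rewrite ler_pdivrMr; [exact: trig_tan_le_bound b2 def2 | apply: (C_gt0 k2 b) => //; lia].
have : (a + b).-1%:R = a%:R + b%:R - 1 :> F.
  by rewrite -natrD -subn1 natrB //; lia.
move=> defab; rewrite defab in le3.
lra.
Qed.

End Trig.

(** * The root of unity exp (i pi / 2N) *)

(** Real and imaginary parts are taken in [algR], a totally ordered field, where the trigonometric
    lemmas apply. *)
Definition algRe (z : algC) : algR := in_algR (Creal_Re z).
Definition algIm (z : algC) : algR := in_algR (Creal_Im z).

Lemma algRe_mul x y : algRe (x * y) = algRe x * algRe y - algIm x * algIm y.
Proof. by apply/val_inj; rewrite /= ReM. Qed.

Lemma algIm_mul x y : algIm (x * y) = algIm x * algRe y + algRe x * algIm y.
Proof. by apply/val_inj; rewrite /= ImM addrC ['Re y * _]mulrC. Qed.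

Lemma sqr_algIm_algRe z : `|z| = 1 -> algIm z ^+ 2 + algRe z ^+ 2 = 1.
Proof.
by move=> z1; apply/val_inj; rewrite /= addrC -normC2_Re_Im z1 expr1n.
Qed.

Lemma algReIm_inj x y : algRe x = algRe y -> algIm x = algIm y -> x = y.
Proof.
by move=> /(congr1 val)/= eqRe /(congr1 val)/= eqIm; apply/eqCP.
Qed.

(* The angle of [x + i y] minus that of [c + i d] lies in [0, pi). *)
Lemma upper_half_div (F : realFieldType) (a b c d : F) :
    0 <= b -> 0 <= d -> b ^+ 2 + a ^+ 2 = 1 -> d ^+ 2 + c ^+ 2 = 1 ->
    a <= c -> c != 1 ->
  0 <= b * c - a * d /\ a < a * c + b * d.
Proof.
move=> b0 d0 ab1 cd1 leac cN1.
have c1 : c < 1 by rewrite lt_def eq_sym cN1; nra.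
have [a_lt0 | a_ge0] := ltP a 0; last first.
  have d_le_b : d <= b by rewrite -(@ler_pXn2r _ 2) ?nnegrE //; nra.
  split; first nra.
  have : d * d <= b * d by rewrite ler_wpM2r.
  have : 0 < (1 - c) * (1 + c - a) by apply: mulr_gt0; lra.
  by rewrite expr2 in cd1; lra.
have pos : 0 < - a * (1 - c) by apply: mulr_gt0; lra.
split; last by have : 0 <= b * d by [exact: mulr_ge0]; lra.
have [c_ge0 | c_lt0] := leP 0 c.
  by have : 0 <= b * c by [exact: mulr_ge0]; have : 0 <= - a * d by [apply: mulr_ge0; lra]; lra.
have b_le_d : b <= d by rewrite -(@ler_pXn2r _ 2) ?nnegrE //; nra.
have : 0 <= (c - a) * d by apply: mulr_ge0; lra.
by have : 0 <= (d - b) * - c by [apply: mulr_ge0; lra]; lra.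
Qed.

Lemma norm_unity_root n (z : algC) : (0 < n)%N -> z ^+ n = 1 -> `|z| = 1.
Proof.
move=> n0 zn; apply/eqP; rewrite -(@pexpr_eq1 _ _ n) // -?lt0n //.
by rewrite -normrX zn normr1.
Qed.

Lemma algIm_ge0P z : 0 <= 'Im z -> 0 <= algIm z. Proof. by []. Qed.

(* Among the 4N-th roots of unity, the non-trivial one in the upper half plane with the
   largest real part is exp (i pi / 2N): dividing by it never leaves the upper half plane. *)
Lemma exists_principal_root N : (0 < N)%N ->
  exists z : algC, [/\ (4 * N).-primitive_root z, z ^+ N = 'i &
    forall j, (j <= N.*2)%N -> 0 <= 'Im (z ^+ j)].
Proof.
move=> N0; pose M := (4 * N)%N; have M0 : (0 < M)%N by rewrite /M; lia.
have [w w_prim] := C_prim_root_exists M0.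
have iM : 'i ^+ M = 1 :> algC.
  by rewrite /M mulnC exprM exprAC (exprM _ 2 2) sqrCi sqrrN !expr1n.
have [k0 def_i] := prim_rootP w_prim iM.
pose Q (k : 'I_M) := (w ^+ k != 1) && (0 <= 'Im (w ^+ k)).
have Qk0 : Q k0.
  rewrite /Q -def_i Im_i ler01 andbT; apply/eqP=> /(congr1 (fun x => 'Im x)).
  by rewrite Im_i (Creal_ImP _ (rpred1 _)) => /eqP; rewrite oner_eq0.
case: (arg_maxP (fun k : 'I_M => algRe (w ^+ k)) Qk0) => k /andP[zN1 Im_z] max_z.
set z := w ^+ k in zN1 Im_z max_z.
have wX1 i : (w ^+ i) ^+ M = 1 by rewrite exprAC (prim_expr_order w_prim) expr1n.
have zM : z ^+ M = 1 by apply: wX1.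
have z_norm := norm_unity_root M0 zM.
have z0 : z != 0 by rewrite -normr_gt0 z_norm.
have Re_z_neq1 : algRe z != 1.
  apply: contra_neq zN1 => Rez1; have := sqr_algIm_algRe z_norm.
  rewrite Rez1 expr1n => /(canRL (addrK _)); rewrite subrr => /eqP.
  rewrite expf_eq0 /= => /eqP Imz0; apply: algReIm_inj; rewrite ?Rez1 ?Imz0; apply/val_inj => /=.
    by rewrite (Creal_ReP _ (rpred1 _)).
  by rewrite (Creal_ImP _ (rpred1 _)).
(* Induction on the number of roots with larger real part than [u]: as long as [u] is not 1,
   dividing by [z] stays in the upper half plane and strictly increases the real part. *)
have descent u : u ^+ M = 1 -> 0 <= 'Im u ->
    exists i, u = z ^+ i /\ forall j, (j <= i)%N -> 0 <= 'Im (z ^+ j).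
  have [m] := ubnP #|[pred l : 'I_M | algRe u < algRe (w ^+ l)]|.
  elim: m u => // m IHm u le_m uM Im_u.
  have [-> | uN1] := eqVneq u 1.
    by exists 0%N; split=> // j; rewrite leqn0 => /eqP->; rewrite (Creal_ImP _ (rpred1 _)).
  have [l def_u] := prim_rootP w_prim uM.
  have le_uz : algRe u <= algRe z by rewrite def_u; apply: max_z; rewrite /Q -def_u uN1.
  have [] := upper_half_div (algIm_ge0P Im_u) (algIm_ge0P Im_z)
    (sqr_algIm_algRe (norm_unity_root M0 uM)) (sqr_algIm_algRe z_norm) le_uz Re_z_neq1.
  have zV : z^-1 = z^* by rewrite invC_norm z_norm expr1n invr1 mul1r.
  have conj_z : algRe z^* = algRe z /\ algIm z^* = - algIm z.
    by split; apply/val_inj; rewrite /= ?Re_conj ?Im_conj.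
  have -> : algIm u * algRe z - algRe u * algIm z = algIm (u / z).
    by rewrite zV algIm_mul conj_z.1 conj_z.2 mulrN.
  have -> : algRe u * algRe z + algIm u * algIm z = algRe (u / z).
    by rewrite zV algRe_mul conj_z.1 conj_z.2 mulrN opprK.
  move=> Im_uz lt_uz; have uzM : (u / z) ^+ M = 1 by rewrite expr_div_n uM zM divr1.
  have lt_m : (#|[pred l : 'I_M | (algRe (u / z) < algRe (w ^+ l))%R]| < m)%N.
    rewrite ltnS in le_m; apply: leq_trans le_m; apply: proper_card; apply/properP; split.
      by apply/subsetP=> l'; rewrite !inE; apply: lt_trans.
    have [l' def_l'] := prim_rootP w_prim uzM.
    by exists l'; rewrite !inE -def_l' ?ltxx.
  have [i [def_uz Im_i']] := IHm _ lt_m uzM Im_uz.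
  exists i.+1; have def_u' : u = z ^+ i.+1 by rewrite exprSr -def_uz divfK.
  split=> // j; rewrite leq_eqVlt => /predU1P[-> | /Im_i' //].
  by rewrite -def_u'.
(* Some primitive root lies in the upper half plane, up to conjugation. By descent it is a power of
   [z], so [z] has full order. *)
have z_prim : M.-primitive_root z.
  have [v [v_prim Im_v]] : exists v : algC, M.-primitive_root v /\ 0 <= 'Im v.
    have [Im_w | Im_w] := real_leP (Creal_Im w) (real0 _); last first.
      by exists w; split=> //; apply: ltW.
    by exists w^*; rewrite fmorph_primitive_root Im_conj oppr_ge0.
  have [i [def_v _]] := descent v (prim_expr_order v_prim) Im_v.
  have [d d_prim dvd_d] := prim_order_exists M0 zM.
  suff -> : M = d by [].
  apply/eqP; rewrite eqn_dvd dvd_d andbT (prim_order_dvd v_prim) def_v.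
  by rewrite exprAC (prim_expr_order d_prim) expr1n.
(* Descent from -1 passes through at least 2N successive powers of [z], because z^i = -1 forces 4N
   to divide 2i. *)
have [||i [def_N1 Im_zi]] := descent (- 1).
- by rewrite /M mulnC exprM exprAC (exprM _ 2 2) sqrrN !expr1n.
- by rewrite (Creal_ImP _ (rpredN1 _)).
have le_i : (N.*2 <= i)%N.
  have : (M %| i * 2)%N by rewrite (prim_order_dvd z_prim) exprM -def_N1 sqrrN expr1n.
  have i0 : (0 < i)%N.
    case: (posnP i) def_N1 => // -> /eqP.
    by rewrite expr0 eq_sym -addr_eq0 -(natrD _ 1 1) pnatr_eq0.
  by rewrite /M => /dvdn_leq; lia.
have Im_ge0 j : (j <= N.*2)%N -> 0 <= 'Im (z ^+ j).
  by move=> le_j; apply: Im_zi; apply: leq_trans le_i.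
exists z; split=> //.
(* By primitivity z^(2N) = -1, so z^N is i or -i; the sign of the imaginary part decides. *)
have : (z ^+ N.*2) ^+ 2 == 1 by rewrite -exprM (_ : (N.*2 * 2 = M)%N) ?zM //; rewrite /M; lia.
rewrite sqrf_eq1 -(prim_order_dvd z_prim) gtnNdvd //=; try by rewrite /M; lia.
rewrite -muln2 exprM -sqrCi eqf_sqr => /orP[/eqP // | /eqP zN].
have := Im_ge0 N ltac:(lia); rewrite zN raddfN /= Im_i oppr_ge0.
by rewrite ler10.
Qed.

Lemma principal_trig_table N (z : algC) : (0 < N)%N -> z ^+ N = 'i ->
    (forall j, (j <= N.*2)%N -> 0 <= 'Im (z ^+ j)) ->
  trig_table N (fun j => algIm (z ^+ j)) (fun j => algRe (z ^+ j)).
Proof.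
move=> N0 zN Im_z; have z1 : `|z| = 1.
  apply: (@norm_unity_root (N * 4)); first by rewrite muln_gt0 N0.
  by rewrite exprM zN (exprM _ 2 2) sqrCi sqrrN expr1n.
split=> [i j | i j | i | | | | | i /Im_z] //.
- by rewrite exprD algIm_mul.
- by rewrite exprD algRe_mul.
- by apply: sqr_algIm_algRe; rewrite normrX z1 expr1n.
- by apply/val_inj; rewrite /= (Creal_ImP _ (rpred1 _)).
- by apply/val_inj; rewrite /= (Creal_ReP _ (rpred1 _)).
- by apply/val_inj; rewrite /= zN Im_i.
- by apply/val_inj; rewrite /= zN Re_i.
Qed.

(** * Energy of an even cycle *)

Lemma factor_XnsubC (F : fieldType) n (w r : F) : n.-primitive_root w -> r != 0 ->
  'X^n - (r ^+ n)%:P = \prod_(j < n) ('X - (r * w ^+ j)%:P).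
Proof.
move=> w_prim r0; have n0 := prim_order_gt0 w_prim.
pose rs := [seq r * w ^+ (j : 'I_n) | j <- index_enum 'I_n].
transitivity (\prod_(x <- rs) ('X - x%:P)); last by rewrite big_map.
have szp := size_XnsubC (r ^+ n) n0.
rewrite {1}(@all_roots_prod_XsubC _ ('X^n - (r ^+ n)%:P) rs).
- by rewrite (monicP (monicXnsubC _ n0)) scale1r.
- by rewrite szp size_map -[index_enum _]enumT size_enum_ord.
- apply/allP=> _ /mapP[j _ ->]; rewrite rootE !hornerE exprMn exprAC.
  by rewrite (prim_expr_order w_prim) expr1n mulr1 subrr.
- rewrite uniq_rootsE map_inj_uniq ?index_enum_uniq // => i j /(mulfI r0)/eqP.
  by rewrite (eq_prim_root_expr w_prim) !modn_small // => /eqP/val_inj.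
Qed.

(** Telescoping: 2 sin k sin ((2j+1) k) = cos (2j k) - cos ((2j+2) k). *)
Lemma trig_sum_odd (F : realFieldType) N (S C : nat -> F) k m : trig_table N S C ->
  2 * S k * \sum_(j < m) S ((2 * j + 1) * k)%N = 1 - C (2 * m * k)%N.
Proof.
move=> T; elim: m => [|m IHm]; first by rewrite big_ord0 mulr0 (trigC0 T) subrr.
rewrite big_ord_recr mulrDr {}IHm /=.
have -> : ((2 * m + 1) * k = 2 * m * k + k)%N by lia.
have -> : (2 * m.+1 * k = 2 * m * k + k.*2)%N by lia.
rewrite (trigDS T) (trigDC T) (trigS_double T) (trigC_double T); ring.
Qed.

(** Telescoping again, to cos k - cos ((2m-1) k). The last cosine is kept expanded, which avoids a
    truncated subtraction at m = 0. *)
Lemma trig_sum_even (F : realFieldType) N (S C : nat -> F) k m : trig_table N S C ->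
  2 * S k * \sum_(j < m) S (2 * j * k)%N =
  C k - (C (2 * m * k)%N * C k + S (2 * m * k)%N * S k).
Proof.
move=> T; elim: m => [|m IHm].
  by rewrite big_ord0 mulr0 (trigC0 T) (trigS0 T) mul0r mul1r addr0 subrr.
rewrite big_ord_recr mulrDr {}IHm /=.
have -> : (2 * m.+1 * k = 2 * m * k + k.*2)%N by lia.
have -> : 2 * S k * S (2 * m * k)%N = 2 * S k * S (2 * m * k)%N * (S k ^+ 2 + C k ^+ 2).
  by rewrite (trig_sqr T) mulr1.
rewrite (trigDS T) (trigDC T) (trigS_double T) (trigC_double T); ring.
Qed.

Section CycleEnergy.

Variables (N : nat) (z : algC).
Hypothesis N_gt0 : (0 < N)%N.
Hypothesis z_prim : (4 * N).-primitive_root z.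
Hypothesis zN : z ^+ N = 'i.
Hypothesis Im_z_ge0 : forall j, (j <= N.*2)%N -> 0 <= 'Im (z ^+ j).

Let S j := algIm (z ^+ j).
Let C j := algRe (z ^+ j).

Let trigT : trig_table N S C := principal_trig_table N_gt0 zN Im_z_ge0.

(* For N = a * k, the value is 2 csc (pi / 2a) or 2 cot (pi / 2a). *)
Definition cycle_energy (a k : nat) (s : int) : algR :=
  2 * (if s == (-1) ^+ a.+1 then 1 else C k) / S k.

(** The factor -i turns real parts into sines. The parity [e] selects the constant term: the power
    of order 2a is (-1)^(a+e). *)
Let root_of (k e j : nat) : algC := - 'i * z ^+ ((2 * j + e) * k).

Lemma factor_even_cycle a k e : (0 < a)%N -> N = (a * k)%N ->
  'X^(2 * a) - ((-1) ^+ (a + e))%:P = \prod_(j < 2 * a) ('X - (root_of k e j)%:P).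
Proof.
move=> a0 defN.
have w_prim : (2 * a).-primitive_root (z ^+ (2 * k)).
  have -> : (2 * k = 4 * N %/ (2 * a))%N.
    by rewrite defN (_ : 4 * (a * k) = 2 * k * (2 * a))%N ?mulnK //; lia.
  by apply: (dvdn_prim_root z_prim); apply/dvdnP; exists (2 * k)%N; lia.
have z0 : z != 0 by rewrite (prim_root_eq0 z_prim); lia.
have r0 : - 'i * z ^+ (e * k) != 0 by rewrite mulf_neq0 ?oppr_eq0 ?neq0Ci ?expf_neq0.
transitivity ('X^(2 * a) - ((- 'i * z ^+ (e * k)) ^+ (2 * a))%:P).
  congr (_ - _%:P); rewrite exprMn -exprM exprM sqrrN sqrCi exprD; congr (_ * _).
  rewrite (_ : e * k * (2 * a) = N * (2 * e))%N; last by lia.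
  by rewrite exprM zN exprM sqrCi.
rewrite (factor_XnsubC w_prim r0); apply: eq_bigr => j _.
rewrite /root_of -mulrA -exprM -exprD; congr ('X - (_ * z ^+ _)%:P); lia.
Qed.

(** As z^(2N) = -1, the second half of the roots is the opposite of the first half, on which all the
    sines are nonnegative. *)
Lemma sum_Re_root_of a k e : (0 < a)%N -> N = (a * k)%N -> (e <= 1)%N ->
  \sum_(j < 2 * a) `|'Re (root_of k e j)| =
  algRval (2 * \sum_(j < a) S ((2 * j + e) * k)%N).
Proof.
move=> a0 defN e1.
have Re_root j : 'Re (root_of k e j) = 'Im (z ^+ ((2 * j + e) * k)).
  by rewrite /root_of mulNr raddfN /= ReMil opprK.
have zN2 : z ^+ N.*2 = -1 by rewrite -muln2 exprM zN sqrCi.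
rewrite mulr_natl mulr2n rmorphD rmorph_sum mul2n -addnn big_split_ord /=.
congr (_ + _); apply: eq_bigr => j _; rewrite Re_root.
  rewrite ger0_norm // Im_z_ge0 //; have := ltn_ord j; nia.
rewrite /= (_ : (2 * (a + j) + e) * k = N.*2 + (2 * j + e) * k)%N; last by lia.
rewrite exprD zN2 mulN1r raddfN normrN /=.
rewrite ger0_norm // Im_z_ge0 //; have := ltn_ord j; nia.
Qed.

Lemma even_cycle_roots a k (s : int) : (0 < a)%N -> N = (a * k)%N ->
    s = 1 \/ s = -1 ->
  exists2 rs : seq algC, 'X^(2 * a) - (s%:~R)%:P = \prod_(x <- rs) ('X - x%:P) &
    \sum_(x <- rs) `|'Re x| = algRval (cycle_energy a k s).
Proof.
move=> a0 defN s1; have k0 : (0 < k)%N by nia.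
pose e : nat := s == (-1) ^+ a.+1.
have e1 : (e <= 1)%N by rewrite /e; case: eqP.
have Sk : S k != 0 by rewrite gt_eqF // (trigS_gt0 trigT) // k0 /=; nia.
exists [seq root_of k e (j : 'I_(2 * a)) | j <- index_enum _].
  rewrite big_map -factor_even_cycle //; congr (_ - _%:P).
  rewrite /e; case: eqP => [-> | ]; first by rewrite rmorphXn rmorphN1 addn1.
  by rewrite addn0 -(signr_odd _ a.+1) -(signr_odd algC a) /=; case: s1 => ->; case: (odd a).
rewrite big_map sum_Re_root_of // /cycle_energy; congr algRval.
rewrite -mulrA; congr (_ * _); apply: (canRL (mulfK Sk)).
have two0 : 2 != 0 :> algR by rewrite pnatr_eq0.
apply: (mulfI two0); rewrite [X in _ * X]mulrC mulrA.
have SN2 : S N.*2 = 0 by rewrite (trigS_double trigT) (trigCN trigT) mulr0.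
have CN2 : C N.*2 = -1.
  by rewrite (trigC_double trigT) (trigSN trigT) expr1n mulr1; lra.
have defN2 : (2 * a * k = N.*2)%N by lia.
rewrite /e; case: eqP => _ /=.
  by rewrite (trig_sum_odd _ _ trigT) defN2 CN2 opprK mulr1.
under eq_bigr do rewrite addn0.
by rewrite (trig_sum_even _ _ trigT) defN2 CN2 SN2 mul0r addr0 mulN1r opprK mulr_natl.
Qed.

Lemma energy_two_even_cycles n (A : 'M[int]_n) m a1 k1 s1 a2 k2 s2 :
    (0 < a1)%N -> N = (a1 * k1)%N -> s1 = 1 \/ s1 = -1 ->
    (0 < a2)%N -> N = (a2 * k2)%N -> s2 = 1 \/ s2 = -1 ->
    char_poly A = 'X^m * ('X^(2 * a1) - s1%:P) * ('X^(2 * a2) - s2%:P) ->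
  energy A = algRval (cycle_energy a1 k1 s1 + cycle_energy a2 k2 s2).
Proof.
move=> a10 def1 s1_1 a20 def2 s2_1 charA.
have [rs1 prod1 sum1] := even_cycle_roots a10 def1 s1_1.
have [rs2 prod2 sum2] := even_cycle_roots a20 def2 s2_1.
rewrite /energy /eigenvalues; case: closed_field_poly_normal => rs /=.
rewrite (monicP (char_poly_monic _)) scale1r -map_char_poly charA.
rewrite !rmorphM !rmorphB /= !map_polyXn !map_polyC /= prod1 prod2.
have -> : 'X^m = \prod_(x <- nseq m (0 : algC)) ('X - x%:P).
  by rewrite big_nseq subr0 iter_mulr_1.
(* Equal products of linear factors have the same roots up to order, so the list of roots chosen in
   [eigenvalues] does not matter. *)
rewrite -!big_cat /= => /prod_XsubC_eq perm_rs.
rewrite -(perm_big _ perm_rs) !big_cat /= sum1 sum2 big_nseq.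
by rewrite (Creal_ReP _ (rpred0 _)) normr0 iter_addr_0 mul0rn add0r.
Qed.

End CycleEnergy.

(** * Characteristic polynomial of a digraph with two disjoint cycles *)

Section NextPerm.

Variable T : finType.
Implicit Types (s : seq T) (g : {perm T}).

(** Used to insert [x] in front of a cycle starting at [y]: only the vertex that closed up on [y] is
    redirected, to [x]. The last hypothesis allows z = y only at the start of the traversal. *)
Lemma next_at_tperm (x y z y1 : T) s : x \notin s -> y \notin s -> z != x ->
  (z != y) || (y1 == y) -> tperm x y (next_at z y y1 s) = next_at z x y1 s.
Proof.
elim: s y1 => [|y' s IHs] y1 /= => [_ _ zx zy | ].
  have [zy1 | zy1] := eqVneq z y1; first by rewrite tpermR.
  have zNy : z != y by case/orP: zy => // /eqP <-.
  by rewrite tpermD // eq_sym.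
rewrite !inE !negb_or => /andP[xy' xs] /andP[yy' ys] zx zy.
have [zy1 | zy1] := eqVneq z y1; first by rewrite tpermD.
apply: IHs => //; case/orP: zy => [-> // | /eqP y1y].
by rewrite -y1y zy1.
Qed.

(** Putting one more vertex in front multiplies the cycle by a transposition, which flips its
    parity. *)
Lemma odd_next_perm s g : uniq s -> s != [::] -> g =1 next s ->
  odd_perm g = ~~ odd (size s).
Proof.
case: s => // x s Us _; elim: s x Us g => [|y s IHs] x Us g def_g.
  suff -> : g = 1%g by rewrite odd_perm1.
  by apply/permP=> z; rewrite def_g perm1 /=; case: eqP.
have [x_ys Uys] : x \notin y :: s /\ uniq (y :: s) by apply/andP.
pose h := perm (can_inj (prev_next Uys)).
have hE : h =1 next (y :: s) by move=> z; rewrite permE.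
have -> : g = (h * tperm x y)%g.
  apply/permP=> z; rewrite permM hE def_g.
  have [-> | zx] := eqVneq z x.
    have -> : next (y :: s) x = x by rewrite next_nth (negPf x_ys).
    by rewrite tpermL /= eqxx.
  rewrite /= (negPf zx) next_at_tperm //.
  - by move: x_ys; rewrite inE negb_or => /andP[].
  - by have /andP[] := Uys.
  - by rewrite eqxx orbT.
rewrite odd_permM odd_tperm (IHs y Uys h hE) /=.
by move: x_ys; rewrite inE negb_or => /andP[-> _]; rewrite addbT.
Qed.

End NextPerm.

(** * Leibniz expansion over the directed cycles *)

Section Dicycles.

Variable n : nat.
Implicit Types (A : 'M[int]_n) (s : seq 'I_n) (C : {set 'I_n * 'I_n}).

Definition next_sign A s : int := \prod_(x in s) A x (next s x).

Lemma arc_fst_inj s : injective (fun x => (x, next s x)).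
Proof. by move=> x y []. Qed.

Lemma mem_arcs_of s x y : ((x, y) \in arcs_of s) = (x \in s) && (y == next s x).
Proof.
apply/imsetP/andP=> [[z zs [-> ->]] | [xs /eqP->]]; first by rewrite eqxx.
by exists x.
Qed.

Lemma cycle_length_arcs_of s : uniq s -> cycle_length (arcs_of s) = size s.
Proof.
by move=> Us; rewrite /cycle_length card_imset; [apply/card_uniqP | apply: arc_fst_inj].
Qed.

Lemma cycle_sign_arcs_of A s : cycle_sign A (arcs_of s) = next_sign A s.
Proof. by rewrite /cycle_sign big_imset //= => x y _ _ []. Qed.

Lemma mem_cycle_vertices s x : (x \in cycle_vertices (arcs_of s)) = (x \in s).
Proof.
apply/imsetP/idP=> [[[y y'] /=]|xs]; first by rewrite mem_arcs_of => /andP[ys _] ->.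
by exists (x, next s x); rewrite // mem_arcs_of xs /=.
Qed.

Section CharPoly.

Variables (A : 'M[int]_n) (s1 s2 : seq 'I_n).
Hypotheses (A0 : forall i, A i i = 0) (U1 : uniq s1) (U2 : uniq s2).
Hypotheses (cyc1 : path.cycle (Defs.arc A) s1) (cyc2 : path.cycle (Defs.arc A) s2).
Hypotheses (gt1_1 : (1 < size s1)%N) (gt1_2 : (1 < size s2)%N).
Hypothesis dis : forall x, x \in s1 -> x \notin s2.
Hypothesis only_two : forall C, is_dicycle A C -> C = arcs_of s1 \/ C = arcs_of s2.

Let g1 := perm (can_inj (prev_next U1)).
Let g2 := perm (can_inj (prev_next U2)).

Let h (b : bool * bool) : {perm 'I_n} := (g1 ^+ b.1 * g2 ^+ b.2)%g.

Let hE b x : h b x = if x \in s1 then (if b.1 then next s1 x else x)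
  else if x \in s2 then (if b.2 then next s2 x else x) else x.
Proof.
have next_out (s : seq 'I_n) y : y \notin s -> next s y = y.
  by move=> ys; rewrite next_nth (negPf ys).
case: b => [] [] [] /=; rewrite /h /= ?expg1 ?expg0 ?mulg1 ?mul1g ?permM ?perm1 ?permE.
- case: ifP => [xs1 | /negbT xs1].
    by rewrite next_out // dis ?mem_next.
  by rewrite (next_out s1) //; case: ifP => // /negbT/next_out.
- by case: ifP => [// | /negbT/next_out ->]; rewrite if_same.
- case: ifP => [xs1 | _]; first by rewrite next_out // dis.
  by case: ifP => // /negbT/next_out.
- by rewrite !if_same.
Qed.

Let next_neq s x : path.cycle (Defs.arc A) s -> x \in s -> next s x != x.
Proof.
by move=> cyc xs; apply: contraTneq (next_cycle cyc xs) => ->; rewrite /Defs.arc A0 eqxx.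
Qed.

(** The orbit of a moved point consists of moved points, so [g] follows arcs along it. It is
    therefore a directed cycle, hence one of the two. *)
Lemma moved_orbit (g : {perm 'I_n}) x :
    (forall i, g i = i \/ A i (g i) != 0) -> g x != x ->
  (x \in s1 /\ {in s1, g =1 next s1}) \/ (x \in s2 /\ {in s2, g =1 next s2}).
Proof.
move=> gA gx; have g_inj := @perm_inj _ g.
pose s := orbit g x.
have nextE y : y \in s -> next s y = g y.
  by move=> ys; rewrite (eqP (next_cycle (cycle_orbit g_inj x) ys)).
have moved y : y \in s -> g y != y.
  rewrite -fconnect_orbit => /iter_findex <-; set k := findex _ _ _.
  by rewrite -iterS iterSr; elim: k => //= k IHk; rewrite (inj_eq g_inj).
have xs : x \in s by apply: in_orbit.
have dic : is_dicycle A (arcs_of s).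
  exists s; split=> //; first exact: orbit_uniq.
  - have : uniq [:: x; g x] by rewrite /= inE eq_sym gx.
    move/uniq_leq_size; apply=> y; rewrite !inE => /orP[]/eqP-> //.
    exact: mem_orbit.
  - apply: cycle_from_next (orbit_uniq _ _) _ => y ys.
    by rewrite nextE //; case: (gA y) => // gy; have := moved _ ys; rewrite gy eqxx.
have eq_s t : arcs_of s = arcs_of t -> x \in t /\ {in t, g =1 next t}.
  move=> eq_st; split.
    have : (x, next s x) \in arcs_of t by rewrite -eq_st mem_arcs_of xs /=.
    by rewrite mem_arcs_of => /andP[].
  move=> y yt; have : (y, next t y) \in arcs_of s by rewrite eq_st mem_arcs_of yt /=.
  by rewrite mem_arcs_of => /andP[ys /eqP ->]; rewrite nextE.
by have [/eq_s | /eq_s] := only_two dic; [left | right].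
Qed.

(** One moved vertex of a cycle forces [g] to rotate that whole cycle, so [g] is determined by which
    of the two cycles it moves. *)
Lemma perm_of_two_cycles (g : {perm 'I_n}) :
  (forall i, g i = i \/ A i (g i) != 0) -> exists b, g = h b.
Proof.
move=> gA; pose moved s := [exists y, (y \in s) && (g y != y)].
exists (moved s1, moved s2); apply/permP=> x; rewrite hE /=.
have fixed s : x \in s -> ~~ moved s -> g x = x.
  move=> xs; rewrite negb_exists => /forallP/(_ x); rewrite xs /=.
  by rewrite negbK => /eqP.
case: ifP => [xs1 | /negbT xs1].
  case: ifP => [/existsP[y /andP[ys1 gy]] | /negbT/fixed]; last exact.
  have [[_ ->] // | [ys2 _]] := moved_orbit gA gy.
  by rewrite (negPf (dis ys1)) in ys2.
case: ifP => [xs2 | /negbT xs2].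
  case: ifP => [/existsP[y /andP[ys2 gy]] | /negbT/fixed]; last exact.
  have [[ys1 _] | [_ ->] //] := moved_orbit gA gy.
  by have := dis ys1; rewrite ys2.
apply/eqP; apply: contraT => /(moved_orbit gA)[] [xs _].
  by rewrite xs in xs1.
by rewrite xs in xs2.
Qed.

Lemma next_pair_inj : injective h.
Proof.
have [x1 x1s1] : exists x, x \in s1.
  by case: (s1) gt1_1 => [|x s] // _; exists x; rewrite mem_head.
have [x2 x2s2] : exists x, x \in s2.
  by case: (s2) gt1_2 => [|x s] // _; exists x; rewrite mem_head.
have x2s1 : (x2 \in s1) = false by apply: contraTF x2s2 => /dis.
move=> [b1 b2] [c1 c2] eq_h; congr (_, _).
  have := congr1 (fun g : {perm _} => g x1) eq_h; rewrite !hE x1s1 /=.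
  have := next_neq cyc1 x1s1.
  by case: b1 {eq_h} c1 => [] [] // /eqP neq; [move/neq | move/esym/neq].
have := congr1 (fun g : {perm _} => g x2) eq_h; rewrite !hE x2s1 x2s2 /=.
have := next_neq cyc2 x2s2.
by case: b2 {eq_h} c2 => [] [] // /eqP neq; [move/neq | move/esym/neq].
Qed.

Let M := char_poly_mx A.

Let M_moved i j : j != i -> M i j = - (A i j)%:P.
Proof. by move=> ji; rewrite !mxE eq_sym (negPf ji) sub0r. Qed.

Let M_fixed i : M i i = 'X.
Proof. by rewrite !mxE eqxx A0 subr0. Qed.

Let weight s (b : bool) : {poly int} := if b then - (next_sign A s)%:P else 'X^(size s).

(** A cycle of length p has signature (-1)^(p-1), and its p entries -a_ij contribute (-1)^p;
    together they leave a single minus sign, whatever the parity of p. *)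
Let prod_weight s (b : bool) : uniq s -> path.cycle (Defs.arc A) s -> (1 < size s)%N ->
  (-1) ^+ (b && ~~ odd (size s)) *
    \prod_(i in s) M i (if b then next s i else i) = weight s b.
Proof.
move=> Us cyc s1_; case: b => /=; last first.
  under eq_bigr do rewrite M_fixed.
  by rewrite prodr_const mul1r (card_uniqP Us).
under eq_bigr => i i_s do rewrite M_moved ?(next_neq cyc) //.
rewrite prodrN (card_uniqP Us) mulrA -(signr_odd _ (size s)) -signr_addb.
by rewrite -rmorph_prod /=; case: (odd _); rewrite /= expr1 mulN1r.
Qed.

Lemma char_poly_two_cycles :
  char_poly A = 'X^(n - size s1 - size s2) *
    ('X^(size s1) - (next_sign A s1)%:P) * ('X^(size s2) - (next_sign A s2)%:P).
Proof.
pose rest := #|[pred i | (i \notin s1) && (i \notin s2)]|.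
have term b : (-1) ^+ h b * \prod_i M i (h b i) =
    'X^rest * weight s1 b.1 * weight s2 b.2.
  rewrite -(prod_weight b.1 U1 cyc1 gt1_1) -(prod_weight b.2 U2 cyc2 gt1_2).
  have -> : odd_perm (h b) =
      (b.1 && ~~ odd (size s1)) (+) (b.2 && ~~ odd (size s2)).
    rewrite odd_permM; congr (_ (+) _).
      case: b.1; rewrite ?expg0 ?odd_perm1 // expg1 (odd_next_perm U1) //.
        by case: (s1) gt1_1.
      by move=> x; rewrite permE.
    case: b.2; rewrite ?expg0 ?odd_perm1 // expg1 (odd_next_perm U2) //.
      by case: (s2) gt1_2.
    by move=> x; rewrite permE.
  rewrite signr_addb (bigID (mem s1)) /= (bigID (mem s2) (fun i => i \notin s1)) /=.
  have -> : \prod_(i in s1) M i (h b i) =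
      \prod_(i in s1) M i (if b.1 then next s1 i else i).
    by apply: eq_bigr => i i1; rewrite hE i1.
  have -> : \prod_(i | (i \notin s1) && (i \in s2)) M i (h b i) =
      \prod_(i in s2) M i (if b.2 then next s2 i else i).
    apply: eq_big => [i | i /andP[/negPf i1 i2]]; last by rewrite hE i1 i2.
    by rewrite andb_idl // => i2; apply: contraTN i2 => /dis.
  have -> : \prod_(i | (i \notin s1) && (i \notin s2)) M i (h b i) = 'X^rest.
    rewrite -prodr_const; apply: eq_big => [i | i /andP[/negPf i1 /negPf i2]] //.
    by rewrite hE i1 i2 M_fixed.
  ring.
have card_rest : rest = (n - size s1 - size s2)%N.
  have := cardC [pred i | (i \in s1) || (i \in s2)]; rewrite card_ord.
  have -> : #|[pred i | (i \in s1) || (i \in s2)]| = (size s1 + size s2)%N.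
    rewrite -size_cat -(card_uniqP (_ : uniq (s1 ++ s2))); last first.
      rewrite cat_uniq U1 U2 andbT /=; apply/hasPn=> i i2.
      by apply: contraTN i2 => /dis.
    by apply: eq_card => i; rewrite mem_cat.
  have -> : #|[predC [pred i | (i \in s1) || (i \in s2)]]| = rest.
    by apply: eq_card => i; rewrite !inE negb_or.
  lia.
(* Any permutation outside the image of [h] sends some vertex to another one without an arc, so its
   term vanishes. The four remaining terms factor. *)
rewrite /char_poly /determinant -/M (bigID (mem (h @: setT))) /=.
rewrite [X in _ + X]big1 ?addr0; last first.
  move=> g g_out; apply/eqP; rewrite mulf_eq0 signr_eq0 /=.
  apply: contraR g_out => /prodf_neq0 g_neq0.
  suff [b ->] : exists b, g = h b by rewrite imset_f.
  apply: perm_of_two_cycles => i; have [gi | gi] := eqVneq (g i) i; first by left.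
  by right; have := g_neq0 i isT; rewrite M_moved // oppr_eq0 polyC_eq0.
rewrite big_imset /=; last by move=> b c _ _; apply: next_pair_inj.
under eq_bigr do rewrite term.
rewrite (eq_bigl predT); last by move=> b; rewrite inE.
rewrite -(pair_bigA _ (fun b1 b2 => 'X^rest * weight s1 b1 * weight s2 b2)) /=.
rewrite !big_bool /= -card_rest /weight.
ring.
Qed.

Lemma size_two_cycles : (size s1 + size s2 <= n)%N.
Proof.
rewrite -size_cat -[leqRHS](card_ord n) -(card_uniqP (_ : uniq (s1 ++ s2))).
  exact: max_card.
rewrite cat_uniq U1 U2 andbT /=; apply/hasPn=> i i2.
by apply: contraTN i2 => /dis.
Qed.

End CharPoly.

End Dicycles.

(** * Existence of the extremal sidigraphs *)

(** The iterates of [next s] reach every vertex of the cycle. This serves to confine cycles to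
    regions that no arc leaves. *)
Lemma next_closed_cycle n (s : seq 'I_n) (P : pred 'I_n) x y : uniq s ->
    {in s, forall z, P z -> P (next s z)} -> x \in s -> y \in s -> P x -> P y.
Proof.
move=> Us clP xs ys Px; have := fconnect_cycle (cycle_next Us) xs y.
rewrite ys => /iter_findex <-; set k := findex _ _ _.
suff /andP[] : (iter k (next s) x \in s) && P (iter k (next s) x) by [].
elim: k => [|k /andP[ks Pk]] /=; first by rewrite xs.
by rewrite mem_next ks clP.
Qed.

(** Inside [t] every vertex has a single successor, so [s] follows [t] and cannot close up before
    exhausting it. *)
Lemma arcs_of_functional_eq n (e : rel 'I_n) (s t : seq 'I_n) :
    uniq s -> uniq t -> s != [::] -> path.cycle e s -> path.cycle e t -> {subset s <= t} ->
    (forall x y y', x \in t -> y \in t -> y' \in t -> e x y -> e x y' -> y = y') ->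
  arcs_of s = arcs_of t.
Proof.
move=> Us Ut s0 cycs cyct sub_st fun_e.
have eq_next x : x \in s -> next s x = next t x.
  move=> xs; have xt := sub_st x xs.
  by apply: (fun_e x); rewrite ?mem_next ?next_cycle ?sub_st ?mem_next.
have [x0 x0s] : exists x, x \in s by case: (s) s0 => // x s' _; exists x; rewrite mem_head.
have sub_ts y : y \in t -> y \in s.
  move=> yt; apply: (next_closed_cycle (P := mem s) Ut _ (sub_st _ x0s) yt x0s).
  by move=> z _ zs; rewrite -[next t z]eq_next // inE mem_next.
apply/setP=> -[x y]; rewrite !mem_arcs_of; apply/andP/andP=> -[xs /eqP ->].
  by rewrite sub_st // eq_next.
by rewrite sub_ts // eq_next // sub_ts.
Qed.

Section Witness.

Variables (n' p q : nat) (sp sq : int).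
Local Notation n := n'.+1.
Hypotheses (p1 : (1 < p)%N) (q1 : (1 < q)%N) (le_pq : (p + q <= n)%N).
Hypotheses (sp1 : sp = 1 \/ sp = -1) (sq1 : sq = 1 \/ sq = -1).

(* The path 0 -> 1 -> ... -> n', closed up by the arcs p - 1 -> 0 and p + q - 1 -> p. *)
Definition two_cycles_mx : 'M[int]_n := \matrix_(i, j)
  if j == i.+1 :> nat then 1
  else if (i == p.-1 :> nat) && (j == 0%N :> nat) then sp
  else if (i == (p + q).-1 :> nat) && (j == p :> nat) then sq
  else 0.

Let A := two_cycles_mx.

Let arcE (i j : 'I_n) : Defs.arc A i j =
  [|| j == i.+1 :> nat, (i == p.-1 :> nat) && (j == 0%N :> nat) |
      (i == (p + q).-1 :> nat) && (j == p :> nat)].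
Proof.
rewrite /Defs.arc mxE; case: ifP => //= _; case: ifP => /= _; first by case: sp1 => ->.
by case: ifP => //= _; case: sq1 => ->.
Qed.

Let seg m k : seq 'I_n := [seq inord i | i <- iota m k].

Let mem_seg m k (x : 'I_n) : (m + k <= n)%N -> (x \in seg m k) = (m <= x < m + k)%N.
Proof.
move=> mk; apply/mapP/idP=> [[i] | mx].
  by rewrite mem_iota => /andP[mi ik] ->; rewrite inordK ?mi //; apply: leq_trans mk.
by exists (val x); rewrite ?mem_iota //= inord_val.
Qed.

Let uniq_seg m k : (m + k <= n)%N -> uniq (seg m k).
Proof.
move=> mk; rewrite map_inj_in_uniq ?iota_uniq // => i j.
rewrite !mem_iota => /andP[_ ik] /andP[_ jk] /(congr1 val) /=.
by rewrite !inordK //; apply: leq_trans mk.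
Qed.

Let size_seg m k : size (seg m k) = k.
Proof. by rewrite size_map size_iota. Qed.

Let cycle_seg m k : (0 < k)%N -> (m + k <= n)%N ->
  Defs.arc A (inord (m + k).-1) (inord m) -> path.cycle (Defs.arc A) (seg m k).
Proof.
case: k => // k _ mk closing; rewrite /seg /= rcons_path.
have -> : last (inord m) [seq inord i | i <- iota m.+1 k] = inord (m + k) :> 'I_n.
  by elim: k m {mk closing} => [|k IHk] m /=; rewrite ?addn0 // IHk addSnnS.
rewrite addnS /= in closing; rewrite closing andbT.
elim: k m mk {closing} => //= k IHk m mk; rewrite IHk ?addSnnS // andbT arcE.
by rewrite !inordK ?eqxx //; lia.
Qed.

Let s1 := seg 0 p.
Let s2 := seg p q.

Let mem_s1 x : (x \in s1) = (x < p)%N.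
Proof. by rewrite mem_seg //; lia. Qed.

Let mem_s2 x : (x \in s2) = (p <= x < p + q)%N.
Proof. by rewrite mem_seg. Qed.

Let U1 : uniq s1. Proof. by apply: uniq_seg; lia. Qed.
Let U2 : uniq s2. Proof. by apply: uniq_seg. Qed.

Let cyc1 : path.cycle (Defs.arc A) s1.
Proof. by apply: cycle_seg; rewrite ?arcE ?inordK //; lia. Qed.

Let cyc2 : path.cycle (Defs.arc A) s2.
Proof. by apply: cycle_seg; rewrite ?arcE ?inordK //; lia. Qed.

Let dic1 : is_dicycle A (arcs_of s1).
Proof. by exists s1; rewrite size_seg. Qed.

Let dic2 : is_dicycle A (arcs_of s2).
Proof. by exists s2; rewrite size_seg. Qed.

Let neq12 : arcs_of s1 != arcs_of s2.
Proof.
have s1_0 : ord0 \in s1 by rewrite mem_s1 /=; lia.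
apply: contraTneq s1_0 => eq12; rewrite -mem_cycle_vertices eq12.
by rewrite mem_cycle_vertices mem_s2 /=; lia.
Qed.

Let sign1 : next_sign A s1 = sp.
Proof.
rewrite /next_sign (bigD1 (inord p.-1)) /=; last by rewrite mem_s1 inordK; lia.
rewrite big1 ?mulr1 => [|x /andP[xs1 xp]].
  have xs1 : inord p.-1 \in s1 by rewrite mem_s1 inordK; lia.
  have := next_cycle cyc1 xs1; have := xs1; rewrite -mem_next mem_s1 arcE mxE.
  rewrite inordK; last by lia.
  by move=> lt_p arc_x; case: ifP; [lia | case: ifP => //; lia].
have := next_cycle cyc1 xs1; have := xs1; rewrite -mem_next mem_s1 arcE mxE.
have : x != p.-1 :> nat by apply: contraNneq xp => xp; apply/eqP/val_inj; rewrite /= inordK; lia.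
move: xs1; rewrite mem_s1 => *.
by case: ifP => //; lia.
Qed.

Let sign2 : next_sign A s2 = sq.
Proof.
rewrite /next_sign (bigD1 (inord (p + q).-1)) /=; last by rewrite mem_s2 inordK; lia.
rewrite big1 ?mulr1 => [|x /andP[xs2 xp]].
  have xs2 : inord (p + q).-1 \in s2 by rewrite mem_s2 inordK; lia.
  have := next_cycle cyc2 xs2; have := xs2; rewrite -mem_next mem_s2 arcE mxE.
  rewrite inordK; last by lia.
  by move=> lt_p arc_x; case: ifP; [lia | case: ifP; [lia | case: ifP => //; lia]].
have := next_cycle cyc2 xs2; have := xs2; rewrite -mem_next mem_s2 arcE mxE.
have : x != (p + q).-1 :> nat.
  by apply: contraNneq xp => xp; apply/eqP/val_inj; rewrite /= inordK; lia.
move: xs2; rewrite mem_s2 => *.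
by case: ifP => //; lia.
Qed.

(** From p + q on, arcs only go up, so a cycle there would have no largest vertex. No arc leads from
    p or above to below p, so each cycle stays in one of the two segments. *)
Let only_two C : is_dicycle A C -> C = arcs_of s1 \/ C = arcs_of s2.
Proof.
case=> s [Us gt1 cyc ->].
have s0 : s != [::] by case: (s) gt1.
have [x0 x0s] : exists x, x \in s by case: (s) s0 => // x s' _; exists x; rewrite mem_head.
have next_arc x : x \in s -> Defs.arc A x (next s x) := next_cycle cyc (x := x).
have lt_pq x : x \in s -> (x < p + q)%N.
  move=> xs; rewrite ltnNge; apply/negP=> le_x.
  pose P := [pred y : 'I_n | (p + q <= y)%N].
  have clP : {in s, forall z, P z -> P (next s z)}.
    by move=> z /next_arc; rewrite arcE /=; lia.
  case: (@arg_maxnP _ x (mem s) val xs) => y ys max_y.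
  have := next_closed_cycle (P := P) Us clP xs ys le_x.
  have := max_y _ (_ : next s y \in s); rewrite mem_next => /(_ ys).
  by have := next_arc y ys; rewrite arcE /=; lia.
have [le_p | lt_p] := leqP p x0; [right | left].
  apply: (@arcs_of_functional_eq _ (Defs.arc A)) => // [y ys | x y y'].
    rewrite mem_s2 lt_pq // andbT.
    apply: (next_closed_cycle (P := [pred y : 'I_n | (p <= y)%N]) Us _ x0s ys le_p).
    by move=> z /next_arc; rewrite arcE /=; lia.
  by rewrite !mem_s2 !arcE => *; apply/val_inj => /=; lia.
apply: (@arcs_of_functional_eq _ (Defs.arc A)) => // [y ys | x y y'].
  rewrite mem_s1 ltnNge; apply/negP=> le_y.
  suff : (p <= x0)%N by lia.
  apply: (next_closed_cycle (P := [pred y : 'I_n | (p <= y)%N]) Us _ ys x0s le_y).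
  by move=> z /next_arc; rewrite arcE /=; lia.
by rewrite !mem_s1 !arcE => *; apply/val_inj => /=; lia.
Qed.

Lemma two_cycles_mx_in_Dns : in_Dns A /\ of_type A p sp q sq.
Proof.
split; last first.
  exists (arcs_of s1), (arcs_of s2); split=> //.
    by rewrite cycle_length_arcs_of // size_seg cycle_sign_arcs_of sign1.
  by rewrite cycle_length_arcs_of // size_seg cycle_sign_arcs_of sign2.
split.
- split=> [i j | i].
    rewrite mxE !inE; case: ifP => // _; case: ifP => _; first by case: sp1 => ->.
    by case: ifP => // _; case: sq1 => ->.
  by apply/eqP; rewrite -[_ == _]negbK -/(Defs.arc A i i) arcE; lia.
- pose e : rel 'I_n := fun x y => Defs.arc A x y || Defs.arc A y x.
  suff : forall u v, connect e u v by [].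
  have e_sym : connect_sym e by apply: sym_connect_sym => x y; rewrite /e orbC.
  have from0 v : connect e ord0 v.
    case: v => m; elim: m => [|m IHm] m_lt.
      by rewrite (_ : Ordinal m_lt = ord0) //; apply/val_inj.
    apply: connect_trans (IHm (ltnW m_lt)) (connect1 _).
    by rewrite /e arcE /= eqxx.
  by move=> u v; apply: connect_trans (from0 v); rewrite e_sym.
- exists (arcs_of s1), (arcs_of s2); split=> //.
  rewrite disjoint_subset; apply/subsetP=> x.
  by rewrite mem_cycle_vertices inE mem_cycle_vertices mem_s1 mem_s2 => ?; lia.
Qed.

End Witness.

(** * Comparison of energies *)

Section InDns.

Variables (n : nat) (A : 'M[int]_n).
Hypothesis DnsA : in_Dns A.

Lemma cycle_sign_pm1 C : is_dicycle A C -> cycle_sign A C = 1 \/ cycle_sign A C = -1.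
Proof.
case: DnsA => -[A_entry _] _ _ [s [_ _ cyc ->]].
rewrite cycle_sign_arcs_of; apply: (big_ind (fun x : int => x = 1 \/ x = -1)).
- by left.
- by move=> x y [->|->] [->|->]; rewrite ?mulr1 ?mul1r ?mulrNN ?mulr1; [left|right|right|left].
move=> x xs; have := next_cycle cyc xs; rewrite /Defs.arc.
by move: (A_entry x (next s x)); rewrite !inE => /or3P[]/eqP->; [right | rewrite eqxx | left].
Qed.

Lemma char_poly_in_Dns C1 C2 : C1 != C2 -> is_dicycle A C1 -> is_dicycle A C2 ->
  let p := cycle_length C1 in let q := cycle_length C2 in
  [/\ (1 < p)%N, (1 < q)%N, (p + q <= n)%N &
    char_poly A = 'X^(n - p - q) * ('X^p - (cycle_sign A C1)%:P)
                                 * ('X^q - (cycle_sign A C2)%:P)].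
Proof.
move=> neq12 dic1 dic2; have [[_ A0] _ [D1 [D2 [_ _ _ disD onlyD]]]] := DnsA.
(* Two distinct directed cycles must be the two given by membership in the class, in one order or
   the other. *)
have [dis only] : [disjoint cycle_vertices C1 & cycle_vertices C2] /\
    forall C, is_dicycle A C -> C = C1 \/ C = C2.
  case: (onlyD C1 dic1) (onlyD C2 dic2) neq12 => -> [] ->; rewrite ?eqxx // => _.
  by rewrite disjoint_sym; split=> // C /onlyD[]; [right | left].
case: dic1 dic2 dis only => [s1 [U1 gt1 cyc1 ->]] [s2 [U2 gt2 cyc2 ->]] dis only /=.
have dis12 x : x \in s1 -> x \notin s2.
  by move=> xs1; rewrite -mem_cycle_vertices (disjointFr dis) ?mem_cycle_vertices.
rewrite !cycle_length_arcs_of // !cycle_sign_arcs_of; split=> //.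
  exact: size_two_cycles.
exact: char_poly_two_cycles.
Qed.

End InDns.

Section Comparison.

Variables (n N : nat) (z : algC).
Hypothesis n_ge4 : (4 <= n)%N.
Hypothesis N8 : (8 %| N)%N.
Hypothesis N_gt0 : (0 < N)%N.
Hypothesis dvdN : forall a, (0 < a)%N -> (a.*2 <= n)%N -> (a.*2 %| N)%N.
Hypothesis z_prim : (4 * N).-primitive_root z.
Hypothesis zN : z ^+ N = 'i.
Hypothesis Im_z_ge0 : forall j, (j <= N.*2)%N -> 0 <= 'Im (z ^+ j).

Let S j := algIm (z ^+ j).
Let C j := algRe (z ^+ j).
Let trigT : trig_table N S C := principal_trig_table N_gt0 zN Im_z_ge0.

(** This index stands for pi / 2a. It is written as a double because the upper bound on the cosecant
    uses its half, pi / 4a. *)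
Let angle a := (N %/ a.*2).*2.
Let csc a := (S (angle a))^-1.

Let angleE a : (0 < a)%N -> (a.*2 <= n)%N -> N = (a * angle a)%N.
Proof. by move=> a0 an; have /divnK := dvdN a0 an; rewrite /angle; lia. Qed.

Let S_gt0 a : (0 < a)%N -> (a.*2 <= n)%N -> 0 < S (angle a).
Proof.
move=> a0 an; apply: (trigS_gt0 trigT); have def_N := angleE a0 an.
have := N_gt0; rewrite [X in (0 < X)%N]def_N muln_gt0 => /andP[_ ->] /=.
by rewrite [leqRHS]def_N leq_pmull.
Qed.

Let csc_mono a b : (0 < a <= b)%N -> (b.*2 <= n)%N -> csc a <= csc b.
Proof.
move=> /andP[a0 ab] bn; have b0 : (0 < b)%N by lia.
have an : (a.*2 <= n)%N by lia.
rewrite lef_pV2 ?posrE ?S_gt0 //; apply: (trigS_mono trigT).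
have def_a := angleE a0 an.
rewrite [X in _ && (_ <= X)%N]def_a leq_pmull // andbT -(leq_pmul2l b0) -(angleE b0 bn).
by rewrite [leqLHS]def_a leq_mul2r ab orbT.
Qed.

Let csc1 : csc 1 = 1.
Proof.
by rewrite /csc (_ : angle 1 = N) ?(trigSN trigT) ?invr1 // [RHS](@angleE 1) ?mul1n //; lia.
Qed.

Let energy_le a s : (0 < a)%N -> (a.*2 <= n)%N -> cycle_energy z a (angle a) s <= 2 * csc a.
Proof.
move=> a0 an; rewrite /cycle_energy /csc ler_wpM2r //; first by rewrite invr_ge0 ltW ?S_gt0.
by rewrite ler_piMr //; case: eqP => // _; exact: (trigC_le1 trigT).
Qed.

Lemma energy_in_Dns (A : 'M[int]_n) (C1 C2 : {set 'I_n * 'I_n}) a b :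
    in_Dns A -> C1 != C2 -> is_dicycle A C1 -> is_dicycle A C2 ->
    cycle_length C1 = a.*2 -> cycle_length C2 = b.*2 ->
  [/\ (0 < a)%N, (0 < b)%N, ((a + b).*2 <= n)%N &
    energy A = algRval (cycle_energy z a (angle a) (cycle_sign A C1)
                      + cycle_energy z b (angle b) (cycle_sign A C2))].
Proof.
move=> DnsA neq12 dic1 dic2 len1 len2.
have [] := char_poly_in_Dns DnsA neq12 dic1 dic2; rewrite len1 len2 => a0 b0 abn charA.
have [a0' b0' abn'] : [/\ (0 < a)%N, (0 < b)%N & ((a + b).*2 <= n)%N] by split; lia.
split=> //; rewrite -!mul2n in charA.
by apply: (energy_two_even_cycles N_gt0 z_prim zN Im_z_ge0 _ _ _ _ _ _ charA) => //;
  do ?[exact: cycle_sign_pm1 | apply: angleE; lia].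
Qed.

(** For half-lengths a and b, a + b <= m + 1, so the energy is at most 2 (D_a + D_b) <= 2 (1 +
    D_(a+b-1)) <= 2 (D_1 + D_m). The chosen signs give both cycles of [T] their cosecant value, so
    this bound is reached. *)
Lemma max_even_attained m (s : int) : (0 < m)%N -> n./2 = m.+1 -> s = (-1) ^+ m.+1 ->
  max_even_attained_by n 2 1 m.*2 s.
Proof.
move=> m0 def_n def_s.
have s_pm1 : s = 1 \/ s = -1.
  by rewrite def_s -signr_odd; case: odd; [right | left].
split.
  case: (n) def_n => // n' def_n.
  by exists (two_cycles_mx n' 2 m.*2 1 s); apply: two_cycles_mx_in_Dns => //; [lia | lia | left].
move=> A T DnsA evenA DnsT [C1 [C2 [neqC dicC1 dicC2 [lenC1 signC1] [lenC2 signC2]]]].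
have [_ _ _ ->] := energy_in_Dns (a := 1) DnsT neqC dicC1 dicC2 lenC1 lenC2.
have [_ _ [D1 [D2 [neqD dicD1 dicD2 _ _]]]] := DnsA.
have [lenD1 lenD2] := (esym (even_halfK (evenA _ dicD1)), esym (even_halfK (evenA _ dicD2))).
have [a0 b0 abn ->] := energy_in_Dns DnsA neqD dicD1 dicD2 lenD1 lenD2.
set a := (cycle_length D1)./2 in a0 abn *; set b := (cycle_length D2)./2 in b0 abn *.
rewrite signC1 signC2 /cycle_energy def_s !eqxx !mulr1.
suff : cycle_energy z a (angle a) (cycle_sign A D1) +
    cycle_energy z b (angle b) (cycle_sign A D2) <= 2 * csc 1 + 2 * csc m by [].
have le_a := @energy_le a (cycle_sign A D1) a0 ltac:(lia).
have le_b := @energy_le b (cycle_sign A D2) b0 ltac:(lia).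
have superadd : csc a + csc b <= 1 + csc (a + b).-1.
  apply: (trig_csc_superadd trigT N_gt0 N8 a0 b0); apply: angleE; lia.
have mono : csc (a + b).-1 <= csc m by apply: csc_mono; lia.
by rewrite csc1; lra.
Qed.

(** Each negative 2-cycle falls in the cotangent case, with value 2 cot (pi / 2) = 0. *)
Lemma energy_negative_2_cycles (T : 'M[int]_n) : in_Dns T -> of_type T 2 (-1) 2 (-1) ->
  energy T = 0.
Proof.
move=> DnsT [C1 [C2 [neqC dicC1 dicC2 [lenC1 signC1] [lenC2 signC2]]]].
have [_ _ _ ->] := energy_in_Dns (a := 1) (b := 1) DnsT neqC dicC1 dicC2 lenC1 lenC2.
have angle1 : angle 1 = N by rewrite [RHS](@angleE 1) ?mul1n //; lia.
rewrite signC1 signC2 /cycle_energy angle1 (_ : -1 == (-1) ^+ 2 = false) //.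
by rewrite -/(C N) (trigCN trigT) mulr0 mul0r addr0.
Qed.

End Comparison.

Theorem theorem3p12 (n : nat) (hn : (5 < n)%N) :
  [/\ (n %% 4 = 0)%N -> max_even_attained_by n 2 1 (n - 2) 1,
      (n %% 4 = 2)%N -> max_even_attained_by n 2 1 (n - 2) (-1),
      (n %% 4 = 1)%N -> max_even_attained_by n 2 1 (n - 3) 1,
      (n %% 4 = 3)%N -> max_even_attained_by n 2 1 (n - 3) (-1) &
      (exists T : 'M[int]_n, in_Dns T /\ of_type T 2 (-1) 2 (-1)) /\
      (forall T : 'M[int]_n, in_Dns T -> of_type T 2 (-1) 2 (-1) ->
         energy T = 0) /\
      (forall S T : 'M[int]_n, in_Dns S -> even_cycles S ->
         in_Dns T -> of_type T 2 (-1) 2 (-1) -> energy T <= energy S)].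
Proof.
(* The factorial is a multiple of 8 and of every even cycle length up to n. *)
pose N := (n + 8)`!.
have N_gt0 : (0 < N)%N := fact_gt0 _.
have dvdN a : (0 < a <= n + 8)%N -> (a %| N)%N by apply: dvdn_fact.
have [z [z_prim zN Im_z]] := exists_principal_root N_gt0.
have maxE m s := @max_even_attained n N z ltac:(lia) (dvdN 8 ltac:(lia)) N_gt0
  (fun a a0 an => dvdN a.*2 ltac:(lia)) z_prim zN Im_z m s.
have minE := @energy_negative_2_cycles n N z ltac:(lia) (dvdN 8 ltac:(lia)) N_gt0
  (fun a a0 an => dvdN a.*2 ltac:(lia)) z_prim zN Im_z.
(* With m = n / 2 - 1 rounded down, m is odd exactly when n is 0 or 1 modulo 4, which gives the
   positive sign. *)
have max_case m (t : nat) (s : int) : n./2 = m.+1 -> t = m.*2 -> s = (-1) ^+ (~~ odd m) ->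
    max_even_attained_by n 2 1 t s.
  by move=> def_m -> ->; apply: maxE => //; [lia | rewrite -(signr_odd _ m.+1)].
split.
- by move=> n4; apply: (@max_case (n./2).-1); [lia | lia | rewrite (_ : odd _ = true) //; lia].
- by move=> n4; apply: (@max_case (n./2).-1); [lia | lia | rewrite (_ : odd _ = false) //; lia].
- by move=> n4; apply: (@max_case (n./2).-1); [lia | lia | rewrite (_ : odd _ = true) //; lia].
- by move=> n4; apply: (@max_case (n./2).-1); [lia | lia | rewrite (_ : odd _ = false) //; lia].
split; last split; [|exact: minE|].
  case: n hn {maxE minE max_case N N_gt0 dvdN z_prim zN Im_z} => // n' hn.
  by exists (two_cycles_mx n' 2 2 (-1) (-1)); apply: two_cycles_mx_in_Dns; try right; lia.
(* Minimality is immediate: an energy is a sum of absolute values. *)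
move=> S T _ _ DnsT typeT; rewrite (minE T) //.
by rewrite sumr_ge0.
Qed.
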